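(* Let $N$ be a positive integer and $a\in\{1,2,\ldots,N\}$. For formal variables $u,v$, $$\sum_{k\geq n+1,\ n\geq 1}t_{N,a}(k-n+1,\{1\}^{n-1})\,u^{k-n-1}v^{n-1}=\frac{1}{a(a-u)}\;{}_3F_2\!\left(\begin{matrix}\frac{a-u}{N},\ \frac{a+v}{N},\ 1\\ \frac{a+N}{N},\ \frac{a+N-u}{N}\end{matrix};1\right).$$
   Context: $\{1\}^{n-1}$ denotes $1$ repeated $n-1$ times. For positive integers $k_1,\ldots,k_n$ with $k_1>1$, $$t_{N,a}(k_1,\ldots,k_n)=\sum_{m_1>\cdots>m_n>0,\ m_i\equiv a\ (\mathrm{mod}\ N)}\frac{1}{m_1^{k_1}\cdots m_n^{k_n}}.$$ The generalized hypergeometric function is $${}_3F_2\!\left(\begin{matrix}b_1,b_2,b_3\\ c_1,c_2\end{matrix};z\right)=\sum_{j=0}^\infty\frac{(b_1)_j(b_2)_j(b_3)_j}{(c_1)_j(c_2)_j}\frac{z^j}{j!},$$ with $(b)_0=1$, $(b)_j=b(b+1)\cdots(b+j-1)$. The identity is one of formal power series in $u,v$: each term of the hypergeometric series is expanded as a power series in $u,v$ and the series is summed coefficientwise. *)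

(* Defs.v *)
From HB Require Import structures.
From mathcomp Require Import all_boot all_order all_algebra.
From mathcomp Require Import all_classical all_reals all_analysis.
Set Implicit Arguments.
Unset Strict Implicit.
Unset Printing Implicit Defensive.
Import Order.TTheory GRing.Theory Num.Theory numFieldNormedType.Exports.
Local Open Scope classical_set_scope.
Local Open Scope ring_scope.

(* The ring R[[X]]. A series is wrapped in a record because [nat -> R] already
   carries the pointwise ring structure. *)
Record fps (R : Type) := Fps { fcoef : nat -> R }.
Arguments Fps {R}.
Arguments fcoef {R}.

HB.instance Definition _ (R : Type) := gen_eqMixin (fps R).
HB.instance Definition _ (R : Type) := gen_choiceMixin (fps R).

Lemma fpsP (R : Type) (f g : fps R) : fcoef f =1 fcoef g -> f = g.
Proof. by case: f g => [f] [g] /funext /= ->. Qed.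

Section FpsZmodule.
Variable R : zmodType.
Implicit Types f g : fps R.

Definition fps_zero : fps R := Fps (fun=> 0).
Definition fps_opp f : fps R := Fps (fun n => - fcoef f n).
Definition fps_add f g : fps R := Fps (fun n => fcoef f n + fcoef g n).

Lemma fps_addA : associative fps_add.
Proof. by move=> f g h; apply: fpsP => n /=; rewrite addrA. Qed.
Lemma fps_addC : commutative fps_add.
Proof. by move=> f g; apply: fpsP => n /=; rewrite addrC. Qed.
Lemma fps_add0 : left_id fps_zero fps_add.
Proof. by move=> f; apply: fpsP => n /=; rewrite add0r. Qed.
Lemma fps_addN : left_inverse fps_zero fps_opp fps_add.
Proof. by move=> f; apply: fpsP => n /=; rewrite addNr. Qed.

HB.instance Definition _ :=
  GRing.isZmodule.Build (fps R) fps_addA fps_addC fps_add0 fps_addN.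

Lemma fcoefD f g n : fcoef (f + g) n = fcoef f n + fcoef g n.
Proof. by []. Qed.
Lemma fcoefN f n : fcoef (- f) n = - fcoef f n.
Proof. by []. Qed.
Lemma fcoef_sum (I : Type) (r : seq I) (P : pred I) (F : I -> fps R) n :
  fcoef (\sum_(i <- r | P i) F i) n = \sum_(i <- r | P i) fcoef (F i) n.
Proof. exact: (big_morph (fun f => fcoef f n)). Qed.

End FpsZmodule.

Section FpsRing.
Variable R : comNzRingType.
Implicit Types f g h : fps R.

Definition fpsC (c : R) : fps R := Fps (fun n => if n == 0%N then c else 0).
Definition fpsX : fps R := Fps (fun n => (n == 1%N)%:R).
Definition fps_mul f g : fps R :=
  Fps (fun n => \sum_(i < n.+1) fcoef f i * fcoef g (n - i)%N).

Definition fps_trunc m f : {poly R} := \poly_(i < m.+1) fcoef f i.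

Lemma fps_truncE m f i : (i <= m)%N -> (fps_trunc m f)`_i = fcoef f i.
Proof. by move=> im; rewrite coef_poly ltnS im. Qed.

Lemma fps_mulE m f g n : (n <= m)%N ->
  fcoef (fps_mul f g) n = (fps_trunc m f * fps_trunc m g)`_n.
Proof.
move=> nm; rewrite coefM; apply: eq_bigr => -[i /= /[!ltnS] ilen] _.
by rewrite !fps_truncE//; [exact: leq_trans (leq_subr _ _) nm|
  exact: leq_trans ilen nm].
Qed.

Lemma fps_mulC : commutative fps_mul.
Proof.
by move=> f g; apply: fpsP => n; rewrite !(fps_mulE _ _ (leqnn n)) mulrC.
Qed.

Lemma fps_mulA : associative fps_mul.
Proof.
move=> f g h; apply: fpsP => n.
have -> : fcoef (fps_mul f (fps_mul g h)) n =
    (fps_trunc n f * (fps_trunc n g * fps_trunc n h))`_n.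
  rewrite coefM; apply: eq_bigr => i _.
  by rewrite (fps_truncE _ (leq_ord i)) (fps_mulE _ _ (leq_subr i n)).
rewrite mulrA coefM; apply: eq_bigr => i _.
by rewrite (fps_truncE _ (leq_subr i n)) (fps_mulE _ _ (leq_ord i)).
Qed.

Lemma fps_mul1 : left_id (fpsC 1) fps_mul.
Proof.
move=> f; apply: fpsP => n /=.
by rewrite big_ord_recl/= mul1r subn0 big1 ?addr0// => i _; rewrite mul0r.
Qed.

Lemma fps_mulDl : left_distributive fps_mul +%R.
Proof.
move=> f g h; apply: fpsP => n /=; rewrite -big_split/=.
by apply: eq_bigr => i _; rewrite mulrDl.
Qed.

Lemma fps_1neq0 : fpsC 1 != 0.
Proof. by apply/eqP => /(congr1 (fcoef ^~ 0%N))/eqP/=; rewrite oner_eq0. Qed.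

HB.instance Definition _ := GRing.Zmodule_isComNzRing.Build (fps R)
  fps_mulA fps_mulC fps_mul1 fps_mulDl fps_1neq0.

Lemma fcoefM f g n :
  fcoef (f * g) n = \sum_(i < n.+1) fcoef f i * fcoef g (n - i)%N.
Proof. by []. Qed.

Lemma fcoef1 n : fcoef (1 : fps R) n = (n == 0%N)%:R.
Proof. by rewrite /=; case: eqP. Qed.

Lemma fcoefCM c f n : fcoef (fpsC c * f) n = c * fcoef f n.
Proof.
by rewrite fcoefM big_ord_recl/= subn0 big1 ?addr0// => i _; rewrite mul0r.
Qed.

Lemma fcoef_exp_lt h k n :
  fcoef h 0 = 0 -> (n < k)%N -> fcoef (h ^+ k) n = 0.
Proof.
move=> h0; elim: k n => // k IH n; rewrite ltnS => nk.
rewrite exprS fcoefM big1// => -[[|i] /= ilt] _; first by rewrite h0 mul0r.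
by rewrite IH ?mulr0//; case: n nk ilt => // n nk _; rewrite subSS
  (leq_ltn_trans (leq_subr _ _)).
Qed.

End FpsRing.

Section FpsUnitRing.
Variable R : comUnitRingType.
Implicit Types f g : fps R.

Definition fps_unit : {pred fps R} := fun f => fcoef f 0 \is a GRing.unit.

(* With c the constant term of f, c^-1 \sum_k (1 - c^-1 f)^k; only the powers
   k <= n contribute to the coefficient of X^n. *)
Definition fps_geom f n : fps R :=
  \sum_(k < n.+1) fpsC (fcoef f 0)^-1 * (1 - fpsC (fcoef f 0)^-1 * f) ^+ k.

Definition fps_inv f : fps R :=
  if f \in fps_unit then Fps (fun n => fcoef (fps_geom f n) n) else f.

Lemma fps_mulVr : {in fps_unit, left_inverse 1 fps_inv *%R}.
Proof.
move=> f uf; rewrite /fps_inv uf mulrC; apply: fpsP => n.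
set c := fcoef f 0; set h := 1 - fpsC c^-1 * f.
have h0 : fcoef h 0 = 0.
  by rewrite /h fcoefD fcoefN fcoefCM/= mulVr// subrr.
have geomE m : (m <= n)%N -> fcoef (fps_geom f m) m = fcoef (fps_geom f n) m.
  move=> mn; rewrite /fps_geom !fcoef_sum -/c -/h.
  rewrite (big_ord_widen n.+1 (fun k => fcoef (fpsC c^-1 * h ^+ k) m))//.
  rewrite big_mkcond; apply: eq_bigr => i _; case: ifPn => //.
  by rewrite -leqNgt => mi; rewrite fcoefCM fcoef_exp_lt ?mulr0.
rewrite fcoefM (eq_bigr (fun i : 'I_n.+1 =>
    fcoef f i * fcoef (fps_geom f n) (n - i)%N)); last first.
  by move=> i _ /=; rewrite geomE// leq_subr.
rewrite -fcoefM.
have -> : f * fps_geom f n = 1 - h ^+ n.+1.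
  rewrite /fps_geom -/c -/h -mulr_sumr mulrA [f * _]mulrC.
  have -> : fpsC c^-1 * f = 1 - h by rewrite /h opprB addrC subrK.
  by rewrite -[1 in RHS](expr1n _ n.+1) subrXX; congr (_ * _);
    apply: eq_bigr => i _; rewrite expr1n mul1r.
by rewrite fcoefD fcoefN fcoef_exp_lt// subr0.
Qed.

Lemma fps_unitP f g : g * f = 1 -> f \in fps_unit.
Proof.
move=> /(congr1 (fcoef ^~ 0%N)); rewrite /= big_ord1 => gf1.
by apply/unitrPr; exists (fcoef g 0); rewrite mulrC.
Qed.

Lemma fps_inv_out : {in [predC fps_unit], fps_inv =1 id}.
Proof. by move=> f; rewrite inE /fps_inv => /negPf ->. Qed.

HB.instance Definition _ := GRing.ComNzRing_hasMulInverse.Build (fps R)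
  fps_mulVr fps_unitP fps_inv_out.

End FpsUnitRing.

(* R[[u, v]], represented as R[[u]][[v]]. *)
Notation fps2 R := (fps (fps R)).

Section Fps2.
Variable R : realType.

Definition fps_u : fps2 R := fpsC (fpsX R).
Definition fps_v : fps2 R := fpsX (fps R).

(* [coef_uv i j f] is the coefficient of u^i v^j in f. *)
Definition coef_uv (i j : nat) (f : fps2 R) : R := fcoef (fcoef f j) i.
Definition Fps_uv (c : nat -> nat -> R) : fps2 R :=
  Fps (fun j => Fps (fun i => c i j)).

Definition fps2_summable (s : nat -> fps2 R) :=
  forall i j, cvgn (series (fun l => coef_uv i j (s l))).
Definition fps2_sum (s : nat -> fps2 R) : fps2 R :=
  Fps_uv (fun i j => limn (series (fun l => coef_uv i j (s l)))).

End Fps2.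
Arguments fps_u {R}.
Arguments fps_v {R}.

Definition pochhammer (A : comUnitRingType) (b : A) (j : nat) : A :=
  \prod_(l < j) (b + l%:R).

Definition hyp3F2_term (A : comUnitRingType) (b1 b2 b3 c1 c2 z : A) (j : nat)
    : A :=
  pochhammer b1 j * pochhammer b2 j * pochhammer b3 j
    / (pochhammer c1 j * pochhammer c2 j) * (z ^+ j / j`!%:R).

Definition hyp3F2 (R : realType) (b1 b2 b3 c1 c2 z : fps2 R) : fps2 R :=
  fps2_sum (hyp3F2_term b1 b2 b3 c1 c2 z).

(* m_1 > ... > m_n > 0 with every m_i congruent to a modulo N *)
Definition mt_index (N a n : nat) : set (seq nat) :=
  [set m | [/\ size m = n, sorted gtn m,
    all (fun x => 0 < x)%N m & all (fun x => x == a %[mod N]) m]].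

(* The sum of nonnegative terms is taken in the extended reals. *)
Definition mt (R : realType) (N a : nat) (k : seq nat) : \bar R :=
  \esum_(m in mt_index N a (size k))
    (\prod_(i < size k) ((nth 0%N m i)%:R ^+ nth 0%N k i)^-1)%:E.

(* The index set {(k, n) | k >= n + 1, n >= 1} is parametrized by the exponents
   i = k - n - 1 of u and j = n - 1 of v. *)
Definition mt_gen (R : realType) (N a : nat) : fps2 R :=
  Fps_uv (fun i j => let n := j.+1 in let k := (i + n + 1)%N in
    fine (mt R N a ((k - n + 1)%N :: nseq (n - 1) 1%N))).

(* Main.v *)
(* Write m_l = a + N l. The l-th term of the hypergeometric series telescopes to
   a (a - u) \prod_(p < l) (1 + v / m_p) / (m_l (m_l - u)), whose expansion
   divided by a (a - u) has at u^i v^j the coefficient m_l^-(i+2) times the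
   j-th elementary symmetric function of 1/m_0, ..., 1/m_(l-1): this is the
   part of t_{N,a}(i+2, {1}^j) with largest index m_l. For convergence, with
   P_l = \prod_(p < l) (1 + c / m_p) and c = N/2, c^j times that symmetric
   function is at most P_l, and P_l / (m_l m_(l+1)) is a constant multiple of
   P_l / m_l - P_(l+1) / m_(l+1), so its sum telescopes. *)
Require Import Defs.
From mathcomp Require Import all_boot all_order all_algebra.
From mathcomp Require Import all_classical all_reals all_analysis.
From mathcomp Require Import ring lra zify.
Local Open Scope classical_set_scope.
Local Open Scope ring_scope.
Set Implicit Arguments.
Unset Strict Implicit.
Unset Printing Implicit Defensive.
Import Order.TTheory GRing.Theory Num.Theory numFieldNormedType.Exports.

(** * Coefficients and units of power series in u and v *)

Section Coefficients.
Variable R : realType.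
Implicit Types f g : fps2 R.

Lemma fps2P f g : (forall i j, coef_uv i j f = coef_uv i j g) -> f = g.
Proof. by move=> fg; apply: fpsP => j; apply: fpsP => i; apply: fg. Qed.

Lemma coef_uvD i j f g : coef_uv i j (f + g) = coef_uv i j f + coef_uv i j g.
Proof. by []. Qed.

Lemma coef_uvB i j f g : coef_uv i j (f - g) = coef_uv i j f - coef_uv i j g.
Proof. by []. Qed.

Lemma coef_uv_natM i j n f : coef_uv i j (n%:R * f) = n%:R * coef_uv i j f.
Proof.
rewrite !mulr_natl; elim: n => [|n IHn]; first by rewrite !mulr0n.
by rewrite !mulrS coef_uvD IHn.
Qed.

Lemma fcoef_fpsXM (A : comNzRingType) (f : fps A) n :
  fcoef (fpsX A * f) n = if n is n'.+1 then fcoef f n' else 0.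
Proof.
rewrite fcoefM big_ord_recl/= mul0r add0r; case: n => [|n].
  by rewrite big_ord0.
rewrite big_ord_recl/= mul1r subn1 big1 ?addr0// => i _.
by rewrite mul0r.
Qed.

Lemma coef_uv_uM i j f :
  coef_uv i j (fps_u * f) = if i is i'.+1 then coef_uv i' j f else 0.
Proof. by rewrite /coef_uv fcoefCM fcoef_fpsXM. Qed.

Lemma coef_uv_vM i j f :
  coef_uv i j (fps_v * f) = if j is j'.+1 then coef_uv i j' f else 0.
Proof. by rewrite /coef_uv fcoef_fpsXM; case: j. Qed.

Lemma fps2_unitE f : (f \is a GRing.unit) = (coef_uv 0 0 f != 0).
Proof.
by rewrite -[LHS]/(fcoef (fcoef f 0) 0 \is a GRing.unit) unitfE.
Qed.

Lemma coef_uv00_nat n : coef_uv 0 0 (n%:R : fps2 R) = n%:R.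
Proof. by rewrite -[_%:R]mulr1 coef_uv_natM mulr1. Qed.

Lemma fps2_nat_unit n : (0 < n)%N -> (n%:R : fps2 R) \is a GRing.unit.
Proof. by move=> n0; rewrite fps2_unitE coef_uv00_nat pnatr_eq0 -lt0n. Qed.

Lemma fps2_natBu_unit n : (0 < n)%N -> (n%:R - fps_u : fps2 R) \is a GRing.unit.
Proof.
by move=> n0; rewrite fps2_unitE coef_uvB coef_uv00_nat subr0 pnatr_eq0 -lt0n.
Qed.

End Coefficients.

(** * The terms of the hypergeometric series, over any commutative ring with units *)

Section Pochhammer.
Variable A : comUnitRingType.
Implicit Types b c : A.

Lemma pochhammer0 b : pochhammer b 0 = 1.
Proof. exact: big_ord0. Qed.

Lemma pochhammerS b k : pochhammer b k.+1 = pochhammer b k * (b + k%:R).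
Proof. exact: big_ord_recr. Qed.

Lemma pochhammer1 k : pochhammer (1 : A) k = k`!%:R.
Proof.
elim: k => [|k IHk]; first exact: pochhammer0.
by rewrite pochhammerS IHk factS mulnC natrM -natr1 addrC.
Qed.

Lemma pochhammer_unit c k :
  (forall l, c + l%:R \is a GRing.unit) -> pochhammer c k \is a GRing.unit.
Proof. by move=> cU; apply: rpred_prod. Qed.

(** The upper parameter 1 contributes [k!], which cancels the factorial of the series. *)
Lemma hyp3F2_term_unit b1 b2 c1 c2 k :
    (forall n, (0 < n)%N -> n%:R \is a @GRing.unit A) ->
  hyp3F2_term b1 b2 1 c1 c2 1 k =
  pochhammer b1 k * pochhammer b2 k / (pochhammer c1 k * pochhammer c2 k).
Proof.
move=> natU; rewrite /hyp3F2_term pochhammer1 expr1n div1r.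
by rewrite [_ * k`!%:R / _]mulrAC mulrK// natU ?fact_gt0.
Qed.

Lemma hyp3F2_termS b1 b2 c1 c2 k :
    (forall n, (0 < n)%N -> n%:R \is a @GRing.unit A) ->
    (forall l, c1 + l%:R \is a GRing.unit) ->
    (forall l, c2 + l%:R \is a GRing.unit) ->
  hyp3F2_term b1 b2 1 c1 c2 1 k.+1 * ((c1 + k%:R) * (c2 + k%:R)) =
  hyp3F2_term b1 b2 1 c1 c2 1 k * ((b1 + k%:R) * (b2 + k%:R)).
Proof.
move=> natU c1U c2U; rewrite !hyp3F2_term_unit// !pochhammerS.
have := pochhammer_unit k c1U; have := pochhammer_unit k c2U.
move: (pochhammer b1 k) (pochhammer b2 k) (pochhammer c1 k) (pochhammer c2 k).
move: (b1 + k%:R) (b2 + k%:R) (c1U k) (c2U k) => x1 x2.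
move: (c1 + k%:R) (c2 + k%:R) => y1 y2 y1U y2U p1 p2 q1 q2 q2U q1U.
have -> : q1 * y1 * (q2 * y2) = y1 * y2 * (q1 * q2) by ring.
rewrite invrM ?unitrM ?q1U ?y1U// [_ * (_^-1 * _)]mulrA divrK ?unitrM ?y1U//.
by set q := _^-1; ring.
Qed.

(** With [m k = a + N k], the ratio of consecutive terms is [(m k - u)(m k + v) / (m k.+1 (m k.+1 -
    u))], so the factors in u telescope. [E] abstracts the remaining product of the
    [1 + v / m p]. *)
Lemma hyp3F2_term_gf (u v : A) (N a : nat) (E : nat -> A) :
    (0 < N)%N -> (0 < a)%N ->
    (forall n, (0 < n)%N -> n%:R \is a @GRing.unit A) ->
    (forall n, (0 < n)%N -> n%:R - u \is a GRing.unit) ->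
    E 0 = 1 ->
    (forall k, (a + N * k)%:R * E k.+1 = ((a + N * k)%:R + v) * E k) ->
  forall k, hyp3F2_term ((a%:R - u) / N%:R) ((a%:R + v) / N%:R) 1
    ((a%:R + N%:R) / N%:R) ((a%:R + N%:R - u) / N%:R) 1 k *
    ((a + N * k)%:R * ((a + N * k)%:R - u)) = a%:R * (a%:R - u) * E k.
Proof.
move=> N0 a0 natU natBuU E0 ES; have NU := natU _ N0.
set b1 := (a%:R - u) / _; set b2 := (a%:R + v) / _.
set c1 := (a%:R + N%:R) / _; set c2 := (a%:R + N%:R - u) / _.
pose m k : A := (a + N * k)%:R.
have NE (x : A) k : N%:R * (x / N%:R + k%:R) = x + (N * k)%:R.
  by rewrite mulrDr mulrC divrK// natrM.
have b1E k : N%:R * (b1 + k%:R) = m k - u by rewrite NE /m natrD; ring.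
have b2E k : N%:R * (b2 + k%:R) = m k + v by rewrite NE /m natrD; ring.
have c1E k : N%:R * (c1 + k%:R) = m k.+1.
  by rewrite NE /m mulnS !natrD; ring.
have c2E k : N%:R * (c2 + k%:R) = m k.+1 - u.
  by rewrite NE /m mulnS !natrD; ring.
have c1U k : c1 + k%:R \is a GRing.unit.
  by rewrite -(unitrMr _ NU) c1E natU// addn_gt0 a0.
have c2U k : c2 + k%:R \is a GRing.unit.
  by rewrite -(unitrMr _ NU) c2E natBuU// addn_gt0 a0.
elim=> [|k IHk].
  by rewrite hyp3F2_term_unit// !pochhammer0 muln0 addn0 E0 !mulr1 divr1 mul1r.
have mU : m k \is a GRing.unit by rewrite natU// addn_gt0 a0.
(* The recurrence for [E] is free of division, so it applies only after multiplication by [m k]. *)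
apply: (mulrI mU); rewrite -/(m k.+1) -c2E -{1}c1E.
have := hyp3F2_termS b1 b2 k natU c1U c2U.
move: (hyp3F2_term _ _ _ _ _ _ _) => t' tS.
transitivity (m k * (N%:R * N%:R * (t' * ((c1 + k%:R) * (c2 + k%:R))))).
  by ring.
move: IHk tS; rewrite -/(m k); move: (hyp3F2_term _ _ _ _ _ _ _) => t IHk ->.
transitivity (t * (m k * (N%:R * (b1 + k%:R))) * (N%:R * (b2 + k%:R))).
  by ring.
rewrite b1E b2E IHk.
transitivity (a%:R * (a%:R - u) * ((m k + v) * E k)); first by ring.
by rewrite -ES -/(m k); ring.
Qed.

End Pochhammer.

(** * Generating functions of the terms *)

Section Generating.
Variables (R : realType) (N a : nat).
Hypotheses (N_gt0 : (0 < N)%N) (a_gt0 : (0 < a)%N).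

Let pt l := (a + N * l)%N.

Let pt_gt0 l : (0 < pt l)%N. Proof. by rewrite addn_gt0 a_gt0. Qed.

(* The j-th elementary symmetric function of 1/m_0, ..., 1/m_(l-1). *)
Fixpoint esymm (j l : nat) : R :=
  if l is l'.+1 then
    esymm j l' + (if j is j'.+1 then esymm j' l' / (pt l')%:R else 0)
  else (j == 0%N)%:R.

Lemma esymm_ge0 j l : 0 <= esymm j l.
Proof.
elim: l j => [|l IHl] [|j] //=; first by rewrite addr0.
by rewrite addr_ge0// divr_ge0.
Qed.

Lemma esymm0 l : esymm 0 l = 1.
Proof. by elim: l => //= l ->; rewrite addr0. Qed.

(** Groups the products by their largest index; this mirrors removing the head of a decreasing
    tuple. *)
Lemma esymmSE j l : esymm j.+1 l = \sum_(p < l) esymm j p / (pt p)%:R.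
Proof. by elim: l => [|l IHl]; rewrite ?big_ord0// big_ord_recr/= -IHl. Qed.

(** The product of the [1 + v / m_p] over [p < l], which is constant in u. *)
Definition esymm_gf l : fps2 R :=
  Fps_uv (fun i j => (i == 0%N)%:R * esymm j l).

Lemma esymm_gfS l :
  (pt l)%:R * esymm_gf l.+1 = ((pt l)%:R + fps_v) * esymm_gf l.
Proof.
have pt0 : (pt l)%:R != 0 :> R by rewrite pnatr_eq0 -lt0n.
apply: fps2P => i j; rewrite mulrDl coef_uvD !coef_uv_natM coef_uv_vM.
rewrite /esymm_gf /coef_uv /=; case: j => [|j]; first by rewrite !addr0.
by field.
Qed.

Definition head_term i j l : R := ((pt l)%:R ^+ i.+2)^-1 * esymm j l.

Lemma head_term_ge0 i j l : 0 <= head_term i j l.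
Proof. by rewrite mulr_ge0 ?invr_ge0 ?exprn_ge0 ?esymm_ge0. Qed.

Definition head_gf l : fps2 R := Fps_uv (fun i j => head_term i j l).

(** This is the geometric expansion of [1 / (m (m - u))] with coefficients [m ^ -(i+2)], multiplied
    out: in [m - u] times the series all powers of u but the zeroth cancel. *)
Lemma head_gfE l :
  head_gf l * ((pt l)%:R * ((pt l)%:R - fps_u)) = esymm_gf l.
Proof.
have pt0 : (pt l)%:R != 0 :> R by rewrite pnatr_eq0 -lt0n.
apply: fps2P => i j; rewrite mulrC -mulrA coef_uv_natM mulrBl coef_uvB.
rewrite coef_uv_natM coef_uv_uM /head_gf /esymm_gf /coef_uv /head_term /=.
case: i => [|i]; rewrite ?mul1r ?subr0; first by field.
by rewrite mul0r !exprS; field; rewrite pt0/= expf_neq0.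
Qed.

Lemma hyp3F2_term_head_gf l :
  hyp3F2_term ((a%:R - fps_u) / N%:R) ((a%:R + fps_v) / N%:R) 1
    ((a%:R + N%:R) / N%:R) ((a%:R + N%:R - fps_u) / N%:R) 1 l =
  a%:R * (a%:R - fps_u) * head_gf l.
Proof.
have dU : (pt l)%:R * ((pt l)%:R - fps_u) \is a @GRing.unit (fps2 R).
  by rewrite unitrM fps2_nat_unit// fps2_natBu_unit.
apply: (mulIr dU); rewrite -[RHS]mulrA head_gfE.
apply: hyp3F2_term_gf => //; [exact: fps2_nat_unit|exact: fps2_natBu_unit| |].
  apply: fps2P => i j; rewrite /coef_uv /=.
  by case: i j => [|i] [|j]; rewrite /= ?mulr1 ?mulr0 ?mul0r.
exact: esymm_gfS.
Qed.

(** * Convergence of the coefficient series *)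

Lemma head_term_summable i j : cvgn (series (head_term i j)).
Proof.
(* With [m = pt l], [Q l - Q l.+1] below equals [P l * (N - c) / (m (m + N))]. This choice lies
   below [N] and makes [N - c = c]. *)
set c : R := N%:R / 2.
have N0 : (0 : R) < N%:R by rewrite ltr0n.
have c0 : 0 < c by rewrite divr_gt0.
have NE : N%:R = c * 2 by rewrite divfK.
clearbody c.
have m1 l : 1 <= (pt l)%:R :> R by rewrite ler1n.
have m0 l : 0 < (pt l)%:R :> R by rewrite ltr0n.
pose P l := \prod_(p < l) (1 + c / (pt p)%:R).
have PS l : P l.+1 = P l * (1 + c / (pt l)%:R) by rewrite /P big_ord_recr.
have P0 l : 0 <= P l.
  by apply: prodr_ge0 => p _; rewrite addr_ge0// divr_ge0// ltW.
have eP l k : c ^+ k * esymm k l <= P l.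
  elim: l k => [|l IHl] k.
    by rewrite /P big_ord0; case: k => [|k] /=; rewrite ?mulr1 ?mulr0.
  rewrite PS /= mulrDr [leRHS]mulrDr mulr1; apply: lerD; first exact: IHl.
  case: k => [|k]; first by rewrite mulr0 mulr_ge0// divr_ge0// ltW.
  have -> : c ^+ k.+1 * (esymm k l / (pt l)%:R) =
      c ^+ k * esymm k l * (c / (pt l)%:R) by rewrite exprS; ring.
  by rewrite ler_wpM2r// divr_ge0// ltW.
pose Q l := P l / (pt l)%:R.
have Q0 l : 0 <= Q l by rewrite divr_ge0.
(* The factor [c ^- j] comes from [eP], [N + 1] from [m (m + N) <= (N + 1) m ^ 2] for [m >= 1], and
   [1 / c] cancels the constant in [Q l - Q l.+1]. *)
pose K := c ^- j * (N%:R + 1) / c.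
have K0 : 0 <= K.
  by rewrite !mulr_ge0 ?invr_ge0 ?exprn_ge0 ?addr_ge0// ltW.
have ptS l : (pt l.+1)%:R = (pt l)%:R + N%:R :> R.
  by rewrite -natrD /pt mulnS; congr (_%:R); lia.
have hQ l : head_term i j l <= K * (Q l - Q l.+1).
  set m : R := (pt l)%:R; have m_gt0 : 0 < m by exact: m0.
  have -> : K * (Q l - Q l.+1) = (N%:R + 1) / (m * (m + N%:R)) * (P l / c ^+ j).
    have mn0 : m != 0 by rewrite gt_eqF.
    have mNn0 : m + c * 2 != 0 by rewrite -NE lt0r_neq0// addr_gt0.
    have cn0 : c != 0 by exact: lt0r_neq0.
    have cjn0 : c ^+ j != 0 by rewrite expf_neq0.
    rewrite /K /Q PS ptS -/m; move: (c ^+ j) cjn0 => d dn0.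
    by rewrite NE; field; rewrite mn0 dn0 cn0 mNn0.
  apply: ler_pM; rewrite ?invr_ge0 ?exprn_ge0 ?esymm_ge0//.
    rewrite -[leLHS]mul1r ler_pdivrMr ?exprn_gt0// mulrAC ler_pdivlMr; last first.
      by rewrite mulr_gt0// addr_gt0.
    rewrite mul1r.
    apply: (@le_trans _ _ ((N%:R + 1) * (m * m))).
      rewrite mulrCA ler_pM2l//; have := m1 l; rewrite -/m; nra.
    rewrite ler_pM2l ?addr_gt0// !exprS mulrA ler_peMr ?mulr_ge0//.
    by rewrite exprn_ege1.
  by rewrite ler_pdivlMr ?exprn_gt0// mulrC.
apply: nondecreasing_is_cvgn.
  by apply/nondecreasing_series => l _ _; exact: head_term_ge0.
exists (K * Q 0) => _ [n _ <-].
apply: (@le_trans _ _ (K * (Q 0 - Q n))).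
  elim: n => [|n IHn]; first by rewrite /series/= big_geq// subrr mulr0.
  rewrite /series/= big_nat_recr//=.
  have -> : Q 0 - Q n.+1 = (Q 0 - Q n) + (Q n - Q n.+1) by ring.
  by rewrite mulrDr lerD.
by rewrite ler_wpM2l// gerBl.
Qed.

(** * Sums over decreasing tuples *)

Hypothesis a_leN : (a <= N)%N.

Definition mt_below j l : set (seq nat) :=
  [set t | mt_index N a j t /\ all (fun y => y < pt l)%N t].

Lemma pt_ltn l l' : (pt l < pt l')%N = (l < l')%N.
Proof. by rewrite ltn_add2l ltn_pmul2l. Qed.

Lemma pt_inj : injective pt.
Proof. by move=> l l' /addnI /eqP; rewrite eqn_pmul2l// => /eqP. Qed.

Lemma pt_mod l : pt l == a %[mod N].
Proof. by rewrite /pt addnC mulnC modnMDl. Qed.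

Lemma ptP y : (0 < y)%N -> y == a %[mod N] -> exists l, y = pt l.
Proof.
move=> y0 ya; have ay : (a <= y)%N.
  rewrite leqNgt; apply/negP => lt_ya; move: ya.
  rewrite modn_small ?(leq_trans lt_ya)//.
  (* For [a = N] the residue is 0, which no positive [y < N] has; for [a < N] both numbers are their
     own residues. *)
  move: a_leN; rewrite leq_eqVlt => /orP[/eqP ->|aN].
    by rewrite modnn; case: y y0 {lt_ya}.
  by rewrite modn_small// ltn_eqF.
rewrite eqn_mod_dvd// in ya; exists ((y - a) %/ N)%N.
by rewrite /pt mulnC divnK// subnKC.
Qed.

Lemma mt_index_cons j l t :
  mt_index N a j.+1 (pt l :: t) <-> mt_below j l t.
Proof.
rewrite /mt_below /mt_index /= pt_gt0 pt_mod /= path_sortedE; last first.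
  by move=> x y z; rewrite /= => yx xz; exact: ltn_trans xz yx.
split=> [[[sz] /andP[lt srt] pos md]|[[-> srt pos md] lt]].
  by split.
by split=> //; apply/andP; split.
Qed.

(** Splitting off the head is a bijection onto pairs of its position and a tail. [L] covers both
    uses: all positions for the full sum, those below [l] for tails. *)
Lemma esum_mt_cons (L : set nat) j (g : seq nat -> \bar R) :
    (forall m, 0 <= g m)%E ->
  \esum_(m in [set m | mt_index N a j.+1 m /\
                       exists2 l, L l & head 0%N m = pt l]) g m =
  \esum_(l in L) \esum_(t in mt_below j l) g (pt l :: t).
Proof.
move=> g0; rewrite esum_esum//.
rewrite (reindex_esum (L `*`` mt_below j) _ (fun lt => pt lt.1 :: lt.2))//.
split=> [[l t] [/= Ll tl]|[l t] [l' t'] _ _ /= [/pt_inj -> ->]//|].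
  by split; [apply/mt_index_cons|exists l].
move=> [|y t] [/= mi [l Ll yE]]; first by case: mi.
rewrite yE in mi *; exists (l, t) => //; split=> //=.
exact/mt_index_cons.
Qed.

(** A decreasing tuple is bounded as soon as its head is. *)
Lemma mt_belowS j l : mt_below j.+1 l =
  [set m | mt_index N a j.+1 m /\ exists2 p, `I_l p & head 0%N m = pt p].
Proof.
apply/seteqP; split=> [[|y t]|[|y t]] /= [mi]; try by case: mi.
  move=> /andP[lt_y _]; split=> //; case: (mi) => _ _ /andP[y0 _] /andP[ya _].
  by have [p yE] := ptP y0 ya; exists p => //; rewrite -pt_ltn -yE.
move=> [p pl yE]; rewrite yE in mi *; split=> //.
have [_ /allP lt_t] := (mt_index_cons _ _ _).1 mi.
rewrite /= pt_ltn pl /=; apply/allP => z /lt_t /ltn_trans; apply.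
by rewrite pt_ltn.
Qed.

Lemma mt_indexS j : mt_index N a j.+1 =
  [set m | mt_index N a j.+1 m /\ exists2 p, [set: nat] p & head 0%N m = pt p].
Proof.
apply/seteqP; split=> [[|y t]|m []//] /=; first by case.
move=> mi; split=> //; case: (mi) => _ _ /andP[y0 _] /andP[ya _].
by have [p ->] := ptP y0 ya; exists p.
Qed.

(** Induction on [j], removing the head; [c] is arbitrary so that it can absorb the reciprocal of
    the removed head. *)
Lemma esum_mt_below j l (c : R) : 0 <= c ->
  \esum_(t in mt_below j l) (c * \prod_(x <- t) x%:R^-1)%:E =
  (c * esymm j l)%:E.
Proof.
have ge0 (d : R) t : 0 <= d -> (0 <= (d * \prod_(x <- t) x%:R^-1)%:E)%E.
  by move=> d0; rewrite lee_fin mulr_ge0// prodr_ge0// => x; rewrite invr_ge0.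
elim: j l c => [|j IHj] l c c0.
  have -> : mt_below 0 l = [set [::]].
    by apply/seteqP; split=> [[|y t] [[]]//|_ ->].
  by rewrite esum_set1 ?ge0// big_nil esymm0.
rewrite mt_belowS esum_mt_cons => [|m]; last exact: ge0.
rewrite (eq_esum (b := fun p => (c * (esymm j p / (pt p)%:R))%:E)); last first.
  move=> p _; transitivity ((c / (pt p)%:R * esymm j p)%:E); last first.
    by congr EFin; ring.
  rewrite -IHj ?divr_ge0//; apply: eq_esum => t _.
  by rewrite big_cons mulrA.
rewrite esum_fset//; last by move=> p _; rewrite lee_fin !mulr_ge0 ?esymm_ge0 ?invr_ge0.
by rewrite -fsbig_ord sumEFin -mulr_sumr esymmSE.
Qed.

Lemma mtE i j : mt R N a (i.+2 :: nseq j 1%N) = (limn (series (head_term i j)))%:E.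
Proof.
rewrite /mt /= size_nseq mt_indexS esum_mt_cons; last first.
  by move=> m; rewrite lee_fin prodr_ge0// => k _; rewrite invr_ge0 exprn_ge0.
transitivity (\esum_(l in [set: nat]) (head_term i j l)%:E).
  apply: eq_esum => l _.
  rewrite -esum_mt_below ?invr_ge0 ?exprn_ge0//; apply: eq_esum => t [[szt _ _ _] _].
  rewrite big_ord_recl /=; congr ((_ * _)%:E).
  rewrite (big_nth 0%N) szt big_mkord; apply: eq_bigr => k _.
  by rewrite nth_nseq ltn_ord expr1.
(* Nonnegativity turns the unordered sum into a series; convergence in the reals then makes its
   value finite. *)
rewrite -nneseries_esumT; last by move=> l; rewrite lee_fin head_term_ge0.
rewrite -EFin_lim; last exact: head_term_summable.
have -> // : EFin \o series (head_term i j) =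
    fun n => (\sum_(0 <= l < n) (head_term i j l)%:E)%E.
by apply: funext => n /=; rewrite sumEFin.
Qed.

End Generating.

(* The first two conjuncts say that the numbers on the left-hand side and the
   coefficientwise sum on the right-hand side are well defined. *)
Theorem corollary2p5 (R : realType) (N a : nat)
    (N_gt0 : (0 < N)%N) (a_gt0 : (0 < a)%N) (a_leN : (a <= N)%N) :
  let u : fps2 R := fps_u in
  let v : fps2 R := fps_v in
  let b1 := (a%:R - u) / N%:R in
  let b2 := (a%:R + v) / N%:R in
  let c1 := (a%:R + N%:R) / N%:R in
  let c2 := (a%:R + N%:R - u) / N%:R in
  [/\ forall k n : nat, (1 <= n)%N -> (n + 1 <= k)%N ->
        mt R N a ((k - n + 1)%N :: nseq (n - 1) 1%N) \is a fin_num,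
      fps2_summable (hyp3F2_term b1 b2 1 c1 c2 1)
    & mt_gen R N a = 1 / (a%:R * (a%:R - u)) * hyp3F2 b1 b2 1 c1 c2 1].
Proof.
move=> u v b1 b2 c1 c2.
pose h i j := head_term R N a i j.
have hcvg i j : cvgn (series (h i j)) by exact: head_term_summable.
(* Multiplication by u shifts the first index, with 0 at [i = 0]. *)
pose h' i j : nat -> R := if i is i'.+1 then h i' j else 0.
have h'0 j : h' 0%N j = 0 *: h 0%N j by rewrite scale0r.
have h'cvg i j : cvgn (series (h' i j)).
  by case: i => [|i]; [rewrite h'0; exact: is_cvg_seriesZ|exact: hcvg].
have zcvg i j : cvgn (series (a%:R *: h i j)) by exact: is_cvg_seriesZ.
have dcvg i j : cvgn (series (a%:R *: h i j - h' i j)).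
  exact: is_cvg_seriesB.
(* Each coefficient is a finite linear combination of head terms, so multiplication by [a (a - u)]
   commutes with the sum. *)
have termE i j : (fun l => coef_uv i j (hyp3F2_term b1 b2 1 c1 c2 1 l)) =
    a%:R *: (a%:R *: h i j - h' i j).
  apply: funext => l; rewrite hyp3F2_term_head_gf// -mulrA coef_uv_natM.
  rewrite mulrBl coef_uvB coef_uv_natM coef_uv_uM.
  by case: i.
split.
- move=> k n n1 nk.
  (* Since [n + 1 <= k], the truncated subtraction is exact and the first exponent is at least 2. *)
  have -> : (k - n + 1 = (k - n - 1).+2)%N by lia.
  by rewrite mtE.
- move=> i j; rewrite termE; exact: is_cvg_seriesZ.
have dU : a%:R * (a%:R - u) \is a GRing.unit.
  by rewrite unitrM fps2_nat_unit// fps2_natBu_unit.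
(* Clearing the prefactor [1 / (a (a - u))] leaves an identity that can be compared
   coefficientwise. *)
rewrite div1r; apply: (mulrI dU); rewrite mulVKr//.
apply: fps2P => i j; rewrite -mulrA coef_uv_natM mulrBl coef_uvB.
rewrite coef_uv_natM coef_uv_uM.
have mt_genE k : coef_uv k j (mt_gen R N a) = limn (series (h k j)).
  rewrite /coef_uv /=.
  have -> : (k + j.+1 + 1 - j.+1 + 1 = k.+2)%N by lia.
  by rewrite subn1 mtE.
rewrite mt_genE /hyp3F2 /fps2_sum [RHS]/coef_uv /= termE.
rewrite (lim_seriesZ _ (dcvg i j)) (lim_seriesB (zcvg i j)) //.
rewrite (lim_seriesZ _ (hcvg i j)).
by case: i => [|i]; rewrite ?mt_genE// h'0 lim_seriesZ// scale0r.
Qed.
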